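(* Let $\mathbf{a}=(a_n)_{n\ge 1}$ be any complex sequence with $\sum_{n=1}^{\infty}|a_n|^2<\infty$. (i) For every real $\alpha$ with $1/2<\alpha\le 3/2$, $$\sum_{n=1}^{\infty}\left|\frac{1}{n^{\alpha}}\sum_{i=1}^{n}\bigl(i^{\alpha}-(i-1)^{\alpha}\bigr)a_i\right|^2\le\left(\frac{2\alpha}{2\alpha-1}\right)^2\sum_{n=1}^{\infty}|a_n|^2 .$$ (ii) For every real $\alpha$ with $1/2<\alpha\le 1$, $$\sum_{n=1}^{\infty}\left|\frac{1}{\sum_{i=1}^{n}i^{\alpha-1}}\sum_{i=1}^{n}i^{\alpha-1}a_i\right|^2\le\left(\frac{2\alpha}{2\alpha-1}\right)^2\sum_{n=1}^{\infty}|a_n|^2 .$$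
   Context: Here $(i-1)^{\alpha}=0$ when $i=1$. *)

(* Defs.v *)
From Stdlib Require Import Reals.
From Coquelicot Require Import Coquelicot.
Open Scope R_scope.

(* n ^ alpha for a natural number n and a real exponent, with 0 ^ alpha = 0.
   Stdlib's [Rpower] cannot be used at 0: since [ln 0 = 0] there,
   [Rpower 0 alpha = 1]. *)
Definition npow (n : nat) (alpha : R) : R :=
  match n with
  | O => 0
  | S _ => Rpower (INR n) alpha
  end.

(* Sequences (a_n)_{n >= 1} are functions on [nat] whose value at 0 is not used:
   both definitions below only read a_1, ..., a_n. *)

Definition power_diff_mean (alpha : R) (a : nat -> C) (n : nat) : C :=
  (RtoC (1 / npow n alpha) *
   sum_n_m (fun i => RtoC (npow i alpha - npow (i - 1) alpha) * a i) 1 n)%C.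

Definition power_weight_mean (alpha : R) (a : nat -> C) (n : nat) : C :=
  (RtoC (1 / sum_n_m (fun i => npow i (alpha - 1)) 1 n) *
   sum_n_m (fun i => RtoC (npow i (alpha - 1)) * a i) 1 n)%C.

(* Main.v *)
Require Import Defs.
From Stdlib Require Import Reals Lra Lia.
From Coquelicot Require Import Coquelicot.
Open Scope R_scope.

(** Let [A n] be the mean of [|a 1|, ..., |a n|] with weights [lam], let [L n] be
    the sum of the first [n] weights, and put [theta = 1 - 1 / (2 alpha)], so that
    the constant to be reached is [1 / theta ^ 2].  By the triangle inequality the
    modulus of a mean of [a] is at most the mean of the moduli, and with
    [rho = L m / lam (m + 1)] the mean determines the sequence through
    [|a (m + 1)| = (1 + rho) * A (m + 1) - rho * A m].

    The inequality therefore says that a tridiagonal quadratic form in the [A n] is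
    nonnegative.  It is split into forms in two consecutive variables
    ([two_term_inequality]),
      [theta^2 x^2 + theta (E + 1/alpha) x^2 <= ((1+rho) x - rho y)^2 + theta E y^2],
    each of which is nonnegative as soon as [theta E <= rho <= E].  When
    [E = m / alpha + e] is affine in [m] of slope [1 / alpha], the terms in [E]
    telescope ([partial_sums_bound]), and the weighted mean inequality follows
    ([weighted_mean_square_series]).  The flexibility matters: [E] need not be
    [rho] itself, it only has to be a majorant within a factor [theta], and that
    is what makes Bernoulli's inequality sufficient to treat powers.

    For [alpha <= 1], both families of weights satisfy
    [n <= L n / lam n <= n / alpha], so [e = 1 / alpha - 1] works
    ([slow_weights_square_series]).  For [1 <= alpha <= 3/2] the weights
    [i^alpha - (i-1)^alpha] satisfy [m / 2 <= rho <= m / alpha], so [e = 0] works,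
    because [theta / alpha <= 1 / 2]. *)

(** * Bernoulli's inequality for real exponents *)

(** Writing [y = exp l], the claim is obtained from [1 + u <= exp u] at
    [u = (a - 1) l] and at [u = - l]. *)
Lemma Rpower_ge_tangent (y a : R) :
  0 < y -> 1 <= a -> 1 + a * (y - 1) <= Rpower y a.
Proof.
  intros Hy Ha. unfold Rpower.
  rewrite <- (exp_ln y Hy) at 1. set (l := ln y).
  replace (a * l) with (l + (a - 1) * l) by ring. rewrite exp_plus.
  assert (H1 := exp_ineq1_le ((a - 1) * l)).
  assert (H2 := exp_ineq1_le (- l)).
  assert (H3 : exp l * exp (- l) = 1)
    by (rewrite <- exp_plus, Rplus_opp_r; apply exp_0).
  assert (H4 := exp_pos l).
  assert (H5 : exp l * (1 - l) <= 1) by nra.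
  assert (H6 : exp l * (1 + (a - 1) * l) <= exp l * exp ((a - 1) * l)) by nra.
  nra.
Qed.

(** Convexity of [exp] between [0] and [l = ln y], obtained by averaging the two
    tangent inequalities at [a l] with weights [a] and [1 - a]. *)
Lemma Rpower_le_tangent (y a : R) :
  0 < y -> 0 <= a <= 1 -> Rpower y a <= 1 + a * (y - 1).
Proof.
  intros Hy Ha. unfold Rpower.
  rewrite <- (exp_ln y Hy) at 2. set (l := ln y).
  assert (H1 := exp_ineq1_le ((1 - a) * l)).
  assert (H2 := exp_ineq1_le (- (a * l))).
  assert (H4 := exp_pos (a * l)).
  assert (E1 : exp (a * l) * exp ((1 - a) * l) = exp l)
    by (rewrite <- exp_plus; f_equal; ring).
  assert (E2 : exp (a * l) * exp (- (a * l)) = 1)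
    by (rewrite <- exp_plus, Rplus_opp_r; apply exp_0).
  assert (H5 : exp (a * l) * (1 + (1 - a) * l) <= exp l) by nra.
  assert (H6 : exp (a * l) * (1 - a * l) <= 1) by nra.
  nra.
Qed.

(** * Weighted means of a square-summable sequence *)

(** As a quadratic form in [x] and [y], the difference of the two sides has a
    positive coefficient [w] at [y ^ 2], so only its determinant matters.  The
    latter is, up to the factor [theta], a concave quadratic polynomial in [rho];
    the identity for [D] writes it as its chord on [[theta E, E]], which is
    nonnegative there, plus a multiple of [(rho - theta E) (E - rho)]. *)
Lemma two_term_inequality (theta E rho x y : R) :
  0 < theta < 1 -> 0 <= E -> 0 < rho -> theta * E <= rho <= E ->
  theta ^ 2 * x ^ 2 + theta * (E + 2 * (1 - theta)) * x ^ 2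
    <= ((1 + rho) * x - rho * y) ^ 2 + theta * E * y ^ 2.
Proof.
  intros Ht HE Hr [H1 H2].
  set (D := (2 - theta) * ((rho - theta * E) * (E - rho))
            + (1 - theta) * (theta * E * (E - rho) + E * (1 - theta))).
  assert (HD : 0 <= D).
  { unfold D.
    assert (0 <= (rho - theta * E) * (E - rho)) by (apply Rmult_le_pos; lra).
    assert (0 <= theta * E) by (apply Rmult_le_pos; lra).
    assert (0 <= theta * E * (E - rho)) by (apply Rmult_le_pos; lra).
    assert (0 <= E * (1 - theta)) by (apply Rmult_le_pos; lra).
    apply Rplus_le_le_0_compat; apply Rmult_le_pos; lra. }
  set (w := rho ^ 2 + theta * E).
  assert (Hw : 0 < w) by (unfold w; nra).
  apply Rmult_le_reg_l with w; [exact Hw|].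
  apply Rminus_le_0.
  replace (w * (((1 + rho) * x - rho * y) ^ 2 + theta * E * y ^ 2) -
           w * (theta ^ 2 * x ^ 2 + theta * (E + 2 * (1 - theta)) * x ^ 2))
    with ((w * y - rho * (1 + rho) * x) ^ 2 + theta * D * x ^ 2)
    by (unfold w, D; ring).
  apply Rplus_le_le_0_compat; [apply pow2_ge_0|].
  apply Rmult_le_pos; [apply Rmult_le_pos; lra | apply pow2_ge_0].
Qed.

Definition weighted_mean (lam : nat -> R) (a : nat -> C) (n : nat) : C :=
  (RtoC (1 / sum_n_m lam 1 n) *
   sum_n_m (fun i => RtoC (lam i) * a i) 1 n)%C.

Lemma sum_from_1_S (u : nat -> R) (n : nat) :
  sum_n_m u 1 (S n) = sum_n_m u 1 n + u (S n).
Proof. rewrite sum_n_Sm by lia. reflexivity. Qed.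

Lemma sum_n_S (u : nat -> R) (n : nat) : sum_n u (S n) = sum_n u n + u (S n).
Proof. exact (sum_Sn u n). Qed.

Lemma sum_from_1_0 (u : nat -> R) : sum_n_m u 1 0 = 0.
Proof. now rewrite sum_n_m_zero by lia. Qed.

Lemma sum_from_1_pos (lam : nat -> R) (n : nat) :
  (forall i, 0 < lam (S i)) -> 0 < sum_n_m lam 1 (S n).
Proof.
  intros Hlam. induction n as [|n IH]; rewrite sum_from_1_S.
  - rewrite sum_from_1_0. specialize (Hlam 0%nat). lra.
  - specialize (Hlam (S n)). lra.
Qed.

Lemma Cmod_weighted_mean_le (lam : nat -> R) (a : nat -> C) (n : nat) :
  (forall i, 0 < lam (S i)) ->
  Cmod (weighted_mean lam a (S n))
    <= sum_n_m (fun i => lam i * Cmod (a i)) 1 (S n) / sum_n_m lam 1 (S n).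
Proof.
  intros Hlam. unfold weighted_mean.
  assert (HL := sum_from_1_pos lam n Hlam).
  assert (HL' := Rinv_0_lt_compat _ HL).
  rewrite Cmod_mult, Cmod_R.
  unfold Rdiv at 1. rewrite Rmult_1_l, Rabs_pos_eq by lra.
  unfold Rdiv. rewrite Rmult_comm. apply Rmult_le_compat_r; [lra|].
  eapply Rle_trans.
  - apply (norm_sum_n_m (V := C_NormedModule)
             (fun i => (RtoC (lam i) * a i)%C) 1 (S n)).
  - apply Req_le, sum_n_m_ext_loc. intros [|k] Hk; [lia|].
    change (Cmod (RtoC (lam (S k)) * a (S k))%C = lam (S k) * Cmod (a (S k))).
    rewrite Cmod_mult, Cmod_R, Rabs_pos_eq; [reflexivity|].
    apply Rlt_le, Hlam.
Qed.

(** Summation of [two_term_inequality] over consecutive means.  The second term on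
    the left is the boundary term of the telescoping; keeping it is what makes the
    induction go through. *)
Lemma partial_sums_bound (theta e : R) (lam b : nat -> R) :
  0 < theta < 1 -> 0 <= e -> theta * e <= (1 - theta) ^ 2 ->
  (forall i, 0 < lam (S i)) ->
  (forall m, theta * (2 * (1 - theta) * INR (S m) + e) * lam (S (S m))
               <= sum_n_m lam 1 (S m)
               <= (2 * (1 - theta) * INR (S m) + e) * lam (S (S m))) ->
  let A := fun n => sum_n_m (fun i => lam i * b i) 1 n / sum_n_m lam 1 n in
  forall n,
  theta ^ 2 * sum_n (fun k => A (S k) ^ 2) n
    + theta * (2 * (1 - theta) * INR (S n) + e) * A (S n) ^ 2
    <= sum_n (fun k => b (S k) ^ 2) n.
Proof.
  intros Ht He Hte Hlam Hr A n. induction n as [|n IH].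
  - rewrite !sum_O.
    (* At the first index the mean is the term itself and there is no previous
       mean: the claim is the bound on [theta * e]. *)
    assert (HA : A 1%nat = b 1%nat).
    { unfold A. rewrite !sum_n_n. specialize (Hlam 0%nat). field. lra. }
    rewrite HA. simpl INR.
    assert (0 <= b 1%nat ^ 2) by apply pow2_ge_0. nra.
  - rewrite !sum_n_S.
    set (l := lam (S (S n))). set (L := sum_n_m lam 1 (S n)).
    assert (Hl : 0 < l) by apply Hlam.
    assert (HL : 0 < L) by (apply sum_from_1_pos; exact Hlam).
    set (E := 2 * (1 - theta) * INR (S n) + e) in *.
    assert (HE : 0 <= E).
    { unfold E. assert (0 <= INR (S n)) by apply pos_INR.
      assert (0 <= (1 - theta) * INR (S n)) by (apply Rmult_le_pos; lra). lra. }
    assert (Hstep := two_term_inequality theta E (L / l)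
                       (A (S (S n))) (A (S n))).
    assert (Hb : (1 + L / l) * A (S (S n)) - L / l * A (S n) = b (S (S n))).
    { unfold A. rewrite !(sum_from_1_S _ (S n)). fold L l. field. lra. }
    rewrite Hb in Hstep.
    assert (HE' : 2 * (1 - theta) * INR (S (S n)) + e = E + 2 * (1 - theta))
      by (unfold E; rewrite (S_INR (S n)); ring).
    rewrite HE'.
    destruct (Hr n) as [H1 H2]. fold E l L in H1, H2.
    assert (H3 : theta * E <= L / l <= E).
    { split; [apply (Rle_div_r _ L l) | apply (Rle_div_l L E l)]; lra. }
    specialize (Hstep Ht HE (Rdiv_lt_0_compat _ _ HL Hl) H3).
    lra.
Qed.

Lemma series_bounded_partial_sums (u : nat -> R) (M : R) :
  (forall n, 0 <= u n) -> (forall n, sum_n u n <= M) ->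
  ex_series u /\ Series u <= M.
Proof.
  intros Hu HM.
  assert (Hex : ex_series u).
  { destruct (ex_finite_lim_seq_incr (sum_n u) M) as [l Hl].
    - intros n. rewrite sum_n_S. specialize (Hu (S n)). lra.
    - exact HM.
    - exists l. exact Hl. }
  split; [exact Hex|].
  assert (Hl : is_lim_seq (sum_n u) (Series u)) by exact (Series_correct _ Hex).
  exact (is_lim_seq_le _ _ _ _ HM Hl (is_lim_seq_const M)).
Qed.

Lemma partial_sum_le_Series (u : nat -> R) (n : nat) :
  (forall k, 0 <= u k) -> ex_series u -> sum_n u n <= Series u.
Proof.
  intros Hu Hex.
  assert (Hl : is_lim_seq (sum_n u) (Series u)) by exact (Series_correct _ Hex).
  apply (is_lim_seq_incr_compare _ _ Hl).
  intros k. rewrite sum_n_S. specialize (Hu (S k)). lra.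
Qed.

(** The constant depends only on the slope [1 / alpha] of the affine majorant
    [E = m / alpha + e].  The smallness condition on [e] comes from the first
    mean, which equals the first term: with [theta = 1 - 1 / (2 alpha)], it says
    that the first boundary term of the telescoping is at most
    [(1 - theta ^ 2) * |a 1| ^ 2]. *)
Lemma weighted_mean_square_series (alpha e : R) (lam : nat -> R) (a : nat -> C) :
  1 / 2 < alpha -> 0 <= e ->
  (1 - 1 / (2 * alpha)) * e <= (1 / (2 * alpha)) ^ 2 ->
  (forall i, 0 < lam (S i)) ->
  (forall m,
     (1 - 1 / (2 * alpha)) * (INR (S m) / alpha + e) * lam (S (S m))
       <= sum_n_m lam 1 (S m)
       <= (INR (S m) / alpha + e) * lam (S (S m))) ->
  ex_series (fun n => Cmod (a (S n)) ^ 2) ->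
  ex_series (fun n => Cmod (weighted_mean lam a (S n)) ^ 2) /\
  Series (fun n => Cmod (weighted_mean lam a (S n)) ^ 2)
    <= (2 * alpha / (2 * alpha - 1)) ^ 2 * Series (fun n => Cmod (a (S n)) ^ 2).
Proof.
  intros Ha He Hte Hlam Hr Hex.
  set (theta := 1 - 1 / (2 * alpha)) in *.
  assert (Hinv : 0 < 1 / (2 * alpha) < 1).
  { split; [apply Rdiv_lt_0_compat; lra|]. apply Rlt_div_l; lra. }
  assert (Ht : 0 < theta < 1) by (unfold theta; lra).
  assert (Hslope : forall x, x / alpha = 2 * (1 - theta) * x)
    by (intros x; unfold theta; field; lra).
  assert (HK : (2 * alpha / (2 * alpha - 1)) ^ 2 = / theta ^ 2)
    by (unfold theta; field; lra).
  rewrite HK.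
  apply series_bounded_partial_sums; [intros; apply pow2_ge_0|].
  intros n.
  set (b := fun i => Cmod (a i)).
  set (A := fun n => sum_n_m (fun i => lam i * b i) 1 n / sum_n_m lam 1 n).
  assert (HA : sum_n (fun k => Cmod (weighted_mean lam a (S k)) ^ 2) n
               <= sum_n (fun k => A (S k) ^ 2) n).
  { apply sum_n_m_le. intros k. apply pow_incr. split; [apply Cmod_ge_0|].
    apply Cmod_weighted_mean_le, Hlam. }
  assert (Hsum : theta ^ 2 * sum_n (fun k => A (S k) ^ 2) n
                 <= sum_n (fun k => b (S k) ^ 2) n).
  { assert (H := partial_sums_bound theta e lam b Ht He).
    replace (1 - theta) with (1 / (2 * alpha)) in H at 1 by (unfold theta; ring).
    specialize (H Hte Hlam).
    assert (Hr' : forall m,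
      theta * (2 * (1 - theta) * INR (S m) + e) * lam (S (S m))
        <= sum_n_m lam 1 (S m)
        <= (2 * (1 - theta) * INR (S m) + e) * lam (S (S m)))
      by (intros m; rewrite <- Hslope; apply Hr).
    specialize (H Hr' n). fold A in H.
    assert (0 <= theta * (2 * (1 - theta) * INR (S n) + e) * A (S n) ^ 2).
    { apply Rmult_le_pos; [|apply pow2_ge_0].
      apply Rmult_le_pos; [lra|]. rewrite <- Hslope.
      apply Rplus_le_le_0_compat; [|exact He].
      apply Rdiv_le_0_compat; [apply pos_INR | lra]. }
    cbv zeta in H. fold A in H. lra. }
  assert (Hb := partial_sum_le_Series (fun k => Cmod (a (S k)) ^ 2) n
                  (fun k => pow2_ge_0 _) Hex).
  fold b in Hb. rewrite Rmult_comm. apply Rle_div_r; [apply pow_lt; lra|].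
  unfold b in *. nra.
Qed.

(** The two bounds say [n <= L n / lam n <= n / alpha] for the partial sums [L n]
    of the weights; the first one holds for decreasing weights.  The majorant of
    [L m / lam (m + 1) = L (m + 1) / lam (m + 1) - 1] that they provide is
    [E = (m + 1) / alpha - 1], and [theta E <= m] since [2 alpha - 1 <= alpha ^ 2]. *)
Lemma slow_weights_square_series (alpha : R) (lam : nat -> R) (a : nat -> C) :
  1 / 2 < alpha <= 1 ->
  (forall i, 0 < lam (S i)) ->
  (forall m, INR m * lam (S m) <= sum_n_m lam 1 m) ->
  (forall m, alpha * sum_n_m lam 1 (S m) <= INR (S m) * lam (S m)) ->
  ex_series (fun n => Cmod (a (S n)) ^ 2) ->
  ex_series (fun n => Cmod (weighted_mean lam a (S n)) ^ 2) /\
  Series (fun n => Cmod (weighted_mean lam a (S n)) ^ 2)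
    <= (2 * alpha / (2 * alpha - 1)) ^ 2 * Series (fun n => Cmod (a (S n)) ^ 2).
Proof.
  intros Ha Hlam Hlow Hup Hex.
  apply weighted_mean_square_series with (e := (1 - alpha) / alpha);
    [lra | apply Rdiv_le_0_compat; lra | | exact Hlam | | exact Hex].
  - apply Rminus_le_0.
    replace ((1 / (2 * alpha)) ^ 2 - (1 - 1 / (2 * alpha)) * ((1 - alpha) / alpha))
      with ((4 * alpha ^ 2 - 6 * alpha + 3) / (4 * alpha ^ 2)) by (field; lra).
    apply Rdiv_le_0_compat; nra.
  - intros m. set (x := INR (S m)).
    assert (Hx : 1 <= x)
      by (unfold x; rewrite S_INR; assert (H := pos_INR m); lra).
    set (l := lam (S (S m))). set (L := sum_n_m lam 1 (S m)).
    assert (Hl : 0 < l) by apply Hlam.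
    assert (H1 : x * l <= L) by apply Hlow.
    assert (H2 : alpha * (L + l) <= (x + 1) * l).
    { assert (H := Hup (S m)). rewrite sum_from_1_S, (S_INR (S m)) in H. exact H. }
    assert (HE : x / alpha + (1 - alpha) / alpha = (x + 1 - alpha) / alpha)
      by (field; lra).
    rewrite HE. split.
    + apply Rle_trans with (2 := H1). apply Rmult_le_compat_r; [lra|].
      apply Rminus_le_0.
      replace (x - (1 - 1 / (2 * alpha)) * ((x + 1 - alpha) / alpha))
        with ((2 * (alpha ^ 2) * x - (2 * alpha - 1) * (x + 1 - alpha))
              / (2 * alpha ^ 2)) by (field; lra).
      (* From [2 alpha - 1 <= alpha ^ 2] and [1 - alpha <= x]. *)
      apply Rdiv_le_0_compat; [|nra].
      assert (2 * alpha - 1 <= alpha ^ 2) by nra. nra.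
    + apply Rmult_le_reg_l with alpha; [lra|].
      replace (alpha * ((x + 1 - alpha) / alpha * l)) with ((x + 1 - alpha) * l)
        by (field; lra).
      lra.
Qed.

(** * Powers of natural numbers *)

Lemma npow_S_pos (n : nat) (alpha : R) : 0 < npow (S n) alpha.
Proof. apply exp_pos. Qed.

Lemma npow_1 (alpha : R) : npow 1 alpha = 1.
Proof. unfold npow, Rpower. simpl INR. rewrite ln_1, Rmult_0_r. apply exp_0. Qed.

Lemma npow_ratio (m n : nat) (alpha : R) :
  npow (S m) alpha = npow (S n) alpha * Rpower (INR (S m) / INR (S n)) alpha.
Proof.
  assert (Hn := lt_0_INR (S n) ltac:(lia)).
  assert (Hm := lt_0_INR (S m) ltac:(lia)).
  change (npow (S n) alpha) with (Rpower (INR (S n)) alpha).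
  rewrite Rpower_mult_distr; [|exact Hn|apply Rdiv_lt_0_compat; assumption].
  replace (INR (S n) * (INR (S m) / INR (S n))) with (INR (S m))
    by (field; lra).
  reflexivity.
Qed.

Lemma npow_pred_exponent (n : nat) (alpha : R) :
  npow (S n) alpha = INR (S n) * npow (S n) (alpha - 1).
Proof.
  assert (Hn := lt_0_INR (S n) ltac:(lia)).
  unfold npow. rewrite <- (Rpower_1 (INR (S n))) at 2 by exact Hn.
  rewrite <- Rpower_plus. f_equal. ring.
Qed.

Lemma sum_npow_diff (alpha : R) (n : nat) :
  sum_n_m (fun i => npow i alpha - npow (i - 1) alpha) 1 n = npow n alpha :> R.
Proof.
  induction n as [|n IH]; [apply sum_from_1_0|].
  rewrite sum_from_1_S, IH. replace (S n - 1)%nat with n by lia. ring.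
Qed.

Lemma npow_lt_succ (alpha : R) (n : nat) :
  0 < alpha -> npow n alpha < npow (S n) alpha.
Proof.
  intros Ha. destruct n as [|n]; [apply npow_S_pos|].
  assert (Hn := lt_0_INR (S n) ltac:(lia)).
  unfold npow, Rpower. apply exp_increasing, Rmult_lt_compat_l; [exact Ha|].
  apply ln_increasing; [exact Hn|]. apply lt_INR. lia.
Qed.

(** By concavity, the increment of the power over [[n, n + 1]] is at least its
    derivative at [n + 1].  Working at the right endpoint is what includes
    [n = 0], where the derivative at the left endpoint is infinite. *)
Lemma npow_diff_lower (alpha : R) (n : nat) :
  0 < alpha <= 1 ->
  alpha * npow (S n) alpha <= INR (S n) * (npow (S n) alpha - npow n alpha).
Proof.
  intros Ha. destruct n as [|n].
  - rewrite npow_1. simpl. lra.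
  - rewrite (npow_ratio n (S n)).
    assert (Hp := npow_S_pos (S n) alpha). set (p := npow (S (S n)) alpha) in *.
    assert (Hx := lt_0_INR (S n) ltac:(lia)).
    rewrite (S_INR (S n)). set (x := INR (S n)) in *.
    assert (Hy : 0 < x / (x + 1)) by (apply Rdiv_lt_0_compat; lra).
    assert (Hq := Rpower_le_tangent _ alpha Hy ltac:(lra)).
    set (q := Rpower (x / (x + 1)) alpha) in *.
    assert (Hq' : (x + 1) * q <= x + 1 - alpha).
    { apply Rle_trans with ((x + 1) * (1 + alpha * (x / (x + 1) - 1))).
      - apply Rmult_le_compat_l; lra.
      - apply Req_le. field. lra. }
    nra.
Qed.

Lemma npow_diff_upper_concave (alpha : R) (m : nat) :
  0 < alpha <= 1 ->
  INR m * (npow (S m) alpha - npow m alpha) <= npow m alpha.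
Proof.
  intros Ha. destruct m as [|m].
  - simpl. lra.
  - rewrite (npow_ratio (S m) m), (S_INR (S m)).
    assert (Hp := npow_S_pos m alpha). set (p := npow (S m) alpha) in *.
    assert (Hx := lt_0_INR (S m) ltac:(lia)). set (x := INR (S m)) in *.
    assert (Hy : 0 < (x + 1) / x) by (apply Rdiv_lt_0_compat; lra).
    assert (Hq := Rpower_le_tangent _ alpha Hy ltac:(lra)).
    set (q := Rpower ((x + 1) / x) alpha) in *.
    assert (Hq' : x * q <= x + alpha).
    { apply Rle_trans with (x * (1 + alpha * ((x + 1) / x - 1))).
      - apply Rmult_le_compat_l; lra.
      - apply Req_le. field. lra. }
    nra.
Qed.

(** The upper bound would fail at [m = 1] for large exponents: it amounts to
    [2 ^ alpha <= 3] there, which [alpha <= 3/2] ensures. *)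
Lemma npow_diff_bounds_convex (alpha : R) (m : nat) :
  1 <= alpha <= 3 / 2 ->
  alpha * npow (S m) alpha
    <= INR (S m) * (npow (S (S m)) alpha - npow (S m) alpha)
    <= 2 * npow (S m) alpha.
Proof.
  intros Ha.
  rewrite (npow_ratio (S m) m), (S_INR (S m)).
  assert (Hp := npow_S_pos m alpha). set (p := npow (S m) alpha) in *.
  assert (Hx1 : 1 <= INR (S m))
    by (rewrite S_INR; assert (H := pos_INR m); lra).
  set (x := INR (S m)) in *.
  assert (Hy : 0 < (x + 1) / x) by (apply Rdiv_lt_0_compat; lra).
  assert (Hxy : x * ((x + 1) / x) = x + 1) by (field; lra).
  assert (Hlow := Rpower_ge_tangent _ alpha Hy ltac:(lra)).
  (* The upper bound comes from the concave case applied to the exponent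
     [alpha - 1], since the power [alpha] itself is convex. *)
  assert (Hup := Rpower_le_tangent _ (alpha - 1) Hy ltac:(lra)).
  assert (Hsplit : Rpower ((x + 1) / x) alpha
                   = (x + 1) / x * Rpower ((x + 1) / x) (alpha - 1)).
  { rewrite <- (Rpower_1 _ Hy) at 2. rewrite <- Rpower_plus. f_equal. ring. }
  set (q := Rpower ((x + 1) / x) alpha) in *.
  set (q' := Rpower ((x + 1) / x) (alpha - 1)) in *.
  set (y := (x + 1) / x) in *.
  assert (Hq1 : x + alpha <= x * q).
  { apply Rle_trans with (x * (1 + alpha * (y - 1))).
    - apply Req_le. nra.
    - apply Rmult_le_compat_l; lra. }
  assert (Hq' : x * q' <= x + 1 / 2) by nra.
  assert (Hq2 : x * q <= x + 2).
  { rewrite Hsplit. apply Rmult_le_reg_l with x; [lra|].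
    replace (x * (x * (y * q'))) with (x * y * (x * q')) by ring.
    rewrite Hxy. nra. }
  split; nra.
Qed.

Lemma npow_succ_le (beta : R) (n : nat) :
  beta <= 0 -> npow (S (S n)) beta <= npow (S n) beta.
Proof.
  intros Hb. assert (Hn := lt_0_INR (S n) ltac:(lia)).
  unfold npow. rewrite <- (Ropp_involutive beta), !(Rpower_Ropp _ (- beta)).
  apply Rinv_le_contravar; [apply exp_pos|].
  apply Rle_Rpower_l; [lra|]. split; [exact Hn|]. apply le_INR. lia.
Qed.

(** * The two families of weights *)

Lemma power_diff_mean_weighted_mean (alpha : R) (a : nat -> C) (n : nat) :
  weighted_mean (fun i => npow i alpha - npow (i - 1) alpha) a n
  = power_diff_mean alpha a n.
Proof. unfold weighted_mean. rewrite sum_npow_diff. reflexivity. Qed.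

Lemma power_diff_weighted_mean_square_series (alpha : R) (a : nat -> C) :
  1 / 2 < alpha <= 3 / 2 ->
  ex_series (fun n => Cmod (a (S n)) ^ 2) ->
  let lam := fun i => npow i alpha - npow (i - 1) alpha in
  ex_series (fun n => Cmod (weighted_mean lam a (S n)) ^ 2) /\
  Series (fun n => Cmod (weighted_mean lam a (S n)) ^ 2)
    <= (2 * alpha / (2 * alpha - 1)) ^ 2 * Series (fun n => Cmod (a (S n)) ^ 2).
Proof.
  intros Ha Hex lam.
  assert (HlamS : forall i, lam (S i) = npow (S i) alpha - npow i alpha)
    by (intros i; unfold lam; now replace (S i - 1)%nat with i by lia).
  assert (Hlam : forall i, 0 < lam (S i)).
  { intros i. rewrite HlamS. assert (H := npow_lt_succ alpha i ltac:(lra)). lra. }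
  destruct (Rle_lt_dec alpha 1) as [H1|H1].
  - apply slow_weights_square_series; [lra | exact Hlam | | | exact Hex];
      intros m; rewrite HlamS; unfold lam; rewrite sum_npow_diff.
    + apply npow_diff_upper_concave. lra.
    + apply npow_diff_lower. lra.
  - apply weighted_mean_square_series with (e := 0);
      [lra | lra | rewrite Rmult_0_r; apply pow2_ge_0 | exact Hlam | | exact Hex].
    intros m. rewrite HlamS. unfold lam at 1 2. rewrite sum_npow_diff.
    destruct (npow_diff_bounds_convex alpha m ltac:(lra)) as [Hlow Hup].
    set (p := npow (S m) alpha) in *.
    set (d := npow (S (S m)) alpha - p) in *. set (x := INR (S m)) in *.
    rewrite Rplus_0_r.
    assert (Hd : 0 <= x * d).
    { apply Rmult_le_pos; [apply pos_INR|].
      assert (H := npow_lt_succ alpha (S m) ltac:(lra)). unfold d, p. lra. }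
    split.
    + apply Rle_trans with (x * d / 2); [|lra].
      apply Rminus_le_0.
      replace (x * d / 2 - (1 - 1 / (2 * alpha)) * (x / alpha) * d)
        with (x * d * ((alpha - 1) ^ 2 / (2 * alpha ^ 2))) by (field; lra).
      apply Rmult_le_pos; [exact Hd|].
      apply Rdiv_le_0_compat; [apply pow2_ge_0 | nra].
    + replace (x / alpha * d) with (x * d / alpha) by (field; lra).
      apply Rle_div_r; lra.
Qed.

Lemma power_weight_mean_square_series (alpha : R) (a : nat -> C) :
  1 / 2 < alpha <= 1 ->
  ex_series (fun n => Cmod (a (S n)) ^ 2) ->
  ex_series (fun n => Cmod (power_weight_mean alpha a (S n)) ^ 2) /\
  Series (fun n => Cmod (power_weight_mean alpha a (S n)) ^ 2)
    <= (2 * alpha / (2 * alpha - 1)) ^ 2 * Series (fun n => Cmod (a (S n)) ^ 2).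
Proof.
  intros Ha Hex.
  apply (slow_weights_square_series alpha (fun i => npow i (alpha - 1)));
    [lra | intros; apply npow_S_pos | | | exact Hex].
  - (* The weights decrease, so the next one is at most each of the first [m]. *)
    induction m as [|m IH].
    + rewrite sum_from_1_0. simpl INR. lra.
    + rewrite sum_from_1_S, S_INR.
      assert (H := npow_succ_le (alpha - 1) m ltac:(lra)).
      assert (Hm := pos_INR m). nra.
  - (* Comparison of each weight with an increment of [n^alpha / alpha]. *)
    intros m. rewrite <- npow_pred_exponent.
    induction m as [|m IH].
    + rewrite sum_n_n, !npow_1. lra.
    + rewrite sum_from_1_S, Rmult_plus_distr_l.
      assert (H := npow_diff_lower alpha (S m) ltac:(lra)).
      assert (Hx := lt_0_INR (S (S m)) ltac:(lia)).
      rewrite (npow_pred_exponent (S m)) in H at 1.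
      assert (alpha * npow (S (S m)) (alpha - 1)
              <= npow (S (S m)) alpha - npow (S m) alpha).
      { apply Rmult_le_reg_l with (INR (S (S m))); [exact Hx|]. lra. }
      lra.
Qed.

(* Coquelicot's [Series u] sums from index 0, so a sum over n >= 1 of u n is
   [Series (fun n => u (S n))]; as [Series] is total, convergence is asserted
   separately. *)
Theorem theorem1p1 (a : nat -> C)
  (ha : ex_series (fun n : nat => Cmod (a (S n)) ^ 2)) :
  (forall alpha : R, 1 / 2 < alpha <= 3 / 2 ->
     ex_series (fun n : nat => Cmod (power_diff_mean alpha a (S n)) ^ 2) /\
     Series (fun n : nat => Cmod (power_diff_mean alpha a (S n)) ^ 2)
       <= (2 * alpha / (2 * alpha - 1)) ^ 2
          * Series (fun n : nat => Cmod (a (S n)) ^ 2)) /\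
  (forall alpha : R, 1 / 2 < alpha <= 1 ->
     ex_series (fun n : nat => Cmod (power_weight_mean alpha a (S n)) ^ 2) /\
     Series (fun n : nat => Cmod (power_weight_mean alpha a (S n)) ^ 2)
       <= (2 * alpha / (2 * alpha - 1)) ^ 2
          * Series (fun n : nat => Cmod (a (S n)) ^ 2)).
Proof.
  split; intros alpha Halpha.
  - destruct (power_diff_weighted_mean_square_series alpha a Halpha ha)
      as [Hex Hle].
    assert (Hext : forall n,
      Cmod (weighted_mean (fun i => npow i alpha - npow (i - 1) alpha) a (S n)) ^ 2
      = Cmod (power_diff_mean alpha a (S n)) ^ 2)
      by (intros n; now rewrite power_diff_mean_weighted_mean).
    split.
    + exact (ex_series_ext _ _ Hext Hex).
    + rewrite <- (Series_ext _ _ Hext). exact Hle.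
  - exact (power_weight_mean_square_series alpha a Halpha ha).
Qed.
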